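(* Let $n\ge 1$ be an integer and let $a(s)=s^n+a_1s^{n-1}+\cdots+a_n\in H^n$ be a monic real Hurwitz stable polynomial of order $n$. Then the set $\Omega^W_{1a}\subset\mathbb{R}^{n-1}$ is a non-empty, bounded, convex subset of $\mathbb{R}^{n-1}$.
   Context: $P^n$ denotes the set of real polynomials of order (exact degree) $n$. $H^n\subset P^n$ denotes the set of Hurwitz stable polynomials of order $n$ (all roots have negative real part). A rational function $p(s)=b(s)/a(s)$ is called weak strictly positive real (WSPR), of order $n$, if $b\in P^{n-1}$, $a\in H^n$, and $\mathrm{Re}[p(j\omega)]>0$ for all $\omega\in\mathbb{R}$, where $j$ is the imaginary unit. For a monic $a\in H^n$, $\Omega^W_{1a}$ is the set of all $(x_1,x_2,\dots,x_{n-1})\in\mathbb{R}^{n-1}$ such that, with $b(s)=s^{n-1}+x_1s^{n-2}+\cdots+x_{n-1}$, the rational function $b(s)/a(s)$ is WSPR. *)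

(* Defs.v *)
From HB Require Import structures.
From mathcomp Require Import all_boot all_order all_algebra.
From mathcomp Require Import complex.
From mathcomp Require Import all_classical all_reals all_analysis.

Set Implicit Arguments.
Unset Strict Implicit.
Unset Printing Implicit Defensive.

Import Order.TTheory GRing.Theory Num.Theory.
Import numFieldNormedType.Exports.

Local Open Scope classical_set_scope.
Local Open Scope ring_scope.

Definition order_polys (R : realType) (n : nat) : set {poly R} :=
  [set p | size p = n.+1].

(* Roots are taken in the complex numbers R[i]. *)
Definition hurwitz_polys (R : realType) (n : nat) : set {poly R} :=
  [set p | order_polys n p /\
    forall z : R[i], root (map_poly (real_complex R) p) z -> complex.Re z < 0].

(* The value of the rational function b(s)/a(s) at a complex point; the
   division of R[i] is total, so this is meaningful where a does not vanish. *)
Definition ratfun_eval (R : realType) (b a : {poly R}) (s : R[i]) : R[i] :=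
  (map_poly (real_complex R) b).[s] / (map_poly (real_complex R) a).[s].

(* A rational function is given by its numerator b and denominator a.  The
   predecessor is truncated, so the order n is meant to be positive. *)
Definition wspr (R : realType) (n : nat) (b a : {poly R}) : Prop :=
  [/\ order_polys n.-1 b, hurwitz_polys n a &
      forall w : R, 0 < complex.Re (ratfun_eval b a (0 +i* w)%C)].

(* s^(n-1) + x_1 s^(n-2) + ... + x_(n-1); the coordinates of x are numbered
   from 0, so x 0 i is the coefficient x_(i+1) of s^(n-1-(i+1)). *)
Definition monic_num (R : realType) (n : nat) (x : 'rV[R]_n.-1) : {poly R} :=
  'X^(n.-1) + \sum_(i < n.-1) x 0 i *: 'X^(n.-1 - i.+1).

Definition OmegaW1 (R : realType) (n : nat) (a : {poly R}) :
    set 'rV[R]_n.-1 :=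
  [set x | wspr n (monic_num x) a].
Arguments OmegaW1 [R] n a _.

(* Main.v *)
(* Write a = prod (s - z), a~ = prod (s + conj z); on the imaginary axis
   a~ = +- conj a.  For a point s0 of the axis put v = a(s0)/a~(s0), so |v| = 1.
   As |a~| < |a| on the right half-plane and |a| < |a~| on the left one, all
   roots r of q = a - v a~ lie on the axis; there q'(r)/a(r) = D(r), where
   D(r) = 2 Re (a'/a)(r) > 0, so they are simple.  If v <> 1, then deg q = n
   and comparing coefficients of s^(n-1) in the Lagrange interpolation of b at
   these roots gives, after taking real parts,
     1/2 = sum_r Re (b/a)(r) / D(r).
   All terms are nonnegative, hence Re (b/a)(s0) <= Re (a'/a)(s0).  The
   polynomial N = b a~ + (-1)^n b^* a, with b^* = conj b on the axis, is thus
   bounded at 2n points of the axis independently of b, and a Bezout relation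
   u a + w a~ = 1 recovers b as the remainder of N w modulo a, which bounds the
   coefficients of b.  Nonemptiness is witnessed by a'/n. *)

Require Import Defs.
From mathcomp Require Import all_boot all_order all_algebra.
From mathcomp Require Import complex separable.
From mathcomp Require Import all_classical all_reals all_analysis.
From mathcomp Require Import ring lra.

Import Order.TTheory GRing.Theory Num.Theory.
Import numFieldNormedType.Exports.

Local Open Scope classical_set_scope.
Local Open Scope ring_scope.

Local Notation prodX rs := (\prod_(z <- rs) ('X - z%:P)).

(** * Products of linear factors and their logarithmic derivative *)

Lemma horner_prodX (F : comNzRingType) (rs : seq F) (x : F) :
  (prodX rs).[x] = \prod_(z <- rs) (x - z).
Proof. by rewrite horner_prod; apply: eq_bigr => z _; rewrite hornerXsubC. Qed.

Lemma size_prodX (F : idomainType) (rs : seq F) :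
  size (prodX rs) = (size rs).+1.
Proof. exact: (size_prod_XsubC rs id). Qed.

Lemma deriv_prodX (F : fieldType) (rs : seq F) (x : F) : x \notin rs ->
  (prodX rs)^`().[x] = (prodX rs).[x] * \sum_(z <- rs) (x - z)^-1.
Proof.
elim: rs => [|z rs IH]; first by rewrite !big_nil derivC !hornerE.
rewrite inE negb_or => /andP[xz xrs].
rewrite !big_cons derivM derivXsubC mul1r hornerD !hornerM hornerXsubC IH //.
have xz0 : x - z != 0 by rewrite subr_eq0.
by field.
Qed.

(** * Lagrange interpolation at distinct nodes *)

Section Lagrange.
Variables (F : fieldType) (rs : seq F).
Hypothesis rs_uniq : uniq rs.

(** Unnormalised basis polynomial; kept monic so that leading coefficients can be compared. *)
Definition lagrange_factor (r : F) : {poly F} :=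
  \prod_(t <- rs | t != r) ('X - t%:P).

Lemma prodX_lagrange_factor r : r \in rs ->
  prodX rs = ('X - r%:P) * lagrange_factor r.
Proof. by move=> rrs; rewrite (bigD1_seq r). Qed.

Lemma monic_lagrange_factor r : lagrange_factor r \is monic.
Proof. exact: monic_prod_XsubC. Qed.

Lemma size_lagrange_factor r : r \in rs ->
  size (lagrange_factor r) = size rs.
Proof.
move=> rrs; apply/eqP; rewrite -eqSS -(size_prodX _ rs).
rewrite (prodX_lagrange_factor r) // size_monicM ?monicXsubC ?monic_neq0 //.
  by rewrite size_XsubC.
exact: monic_lagrange_factor.
Qed.

Lemma root_lagrange_factor r t : t \in rs ->
  root (lagrange_factor r) t = (t != r).
Proof.
move=> trs; rewrite /lagrange_factor -big_filter root_prod_XsubC mem_filter.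
by rewrite trs andbT.
Qed.

Lemma deriv_prodX_root r : r \in rs ->
  (prodX rs)^`().[r] = (lagrange_factor r).[r].
Proof.
move=> rrs; rewrite (prodX_lagrange_factor _ rrs) derivM derivXsubC.
by rewrite !hornerE subrr mul0r addr0.
Qed.

(** The difference of the two sides vanishes at more points than its degree allows. *)
Lemma lagrange_interpolation (p : {poly F}) : (size p <= size rs)%N ->
  p = \sum_(r <- rs) (p.[r] / (lagrange_factor r).[r]) *: lagrange_factor r.
Proof.
move=> sp; apply/eqP; rewrite -subr_eq0; apply/eqP.
apply: (@roots_geq_poly_eq0 _ _ rs) => //.
  apply/allP => t trs; rewrite rootE hornerD hornerN horner_sum subr_eq0.
  rewrite (bigD1_seq t) //= big1 ?addr0.
    by rewrite hornerZ divfK // -rootE root_lagrange_factor ?eqxx.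
  move=> r rt; rewrite hornerZ (_ : _.[t] = 0) ?mulr0 //.
  by apply/rootP; rewrite root_lagrange_factor // eq_sym.
rewrite (leq_trans (size_polyD _ _)) // geq_max sp size_polyN.
rewrite (leq_trans (size_sum _ _ _)) //.
apply/bigmax_leqP_seq => r rrs _.
by rewrite (leq_trans (size_scale_leq _ _)) ?size_lagrange_factor.
Qed.

End Lagrange.

(** * Reflection in the imaginary axis and the pointwise bound on the real part *)

Section HermiteBiehler.
Variable R : realType.
Implicit Types (zs : seq R[i]) (s v z : R[i]).

Local Notation Rez z := (complex.Re z) (only parsing).

(** Roots reflected in the imaginary axis; [prodX (mirror zs)] is the a~ of the overview. *)
Definition mirror zs : seq R[i] := [seq - conjc z | z <- zs].

Lemma ReD (x y : R[i]) : Rez (x + y) = Rez x + Rez y.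
Proof. by case: x y => ? ? []. Qed.

Lemma Re_sum (I : Type) (r : seq I) (P : pred I) (f : I -> R[i]) :
  Rez (\sum_(i <- r | P i) f i) = \sum_(i <- r | P i) Rez (f i).
Proof. exact: (big_morph _ ReD). Qed.

Lemma Re_realM (k : R) z : Rez (real_complex R k * z) = k * Rez z.
Proof. by case: z => x y /=; rewrite mul0r subr0. Qed.

Lemma Re_inv_gt0 z : 0 < Rez z -> 0 < Rez z^-1.
Proof.
case: z => x y /= x0; rewrite divr_gt0 //.
by rewrite ltr_wpDr ?sqr_ge0 // exprn_gt0.
Qed.

Lemma conjc_axis s : Rez s = 0 -> conjc s = - s.
Proof. by case: s => x y /= ->; apply/eqP; rewrite eq_complex /= oppr0 !eqxx. Qed.

(** Since conj s = -s, each factor s + conj z equals -conj (s - z). *)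
Lemma horner_mirror zs s : Rez s = 0 ->
  (prodX (mirror zs)).[s] = (-1) ^+ size zs * conjc (prodX zs).[s].
Proof.
move=> /conjc_axis s0; rewrite !horner_prodX big_map rmorph_prod.
rewrite -sum1_size -prodrXr -big_split.
apply: eq_bigr => z _; rewrite rmorphB /= s0; ring.
Qed.

(** Factor by factor: |s - z|^2 - |s + conj z|^2 = -4 Re s Re z. *)
Lemma norm_mirror_lt zs s : zs != [::] -> {in zs, forall z, Rez z < 0} ->
  0 < Rez s -> `|(prodX (mirror zs)).[s]| < `|(prodX zs).[s]|.
Proof.
move=> zs0 zsN s0; rewrite !horner_prodX big_map !normr_prod big_seq [ltRHS]big_seq.
apply: ltr_prod.
  by case: zs zs0 {zsN} => //= z zs _; rewrite inE eqxx.
move=> z /zsN {zsN zs0}; rewrite normr_ge0 /=.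
rewrite -(ltr_pXn2r (n := 2)) ?nnegrE ?normr_ge0 // -!add_Re2_Im2 ltcR.
case: z s s0 => x y [x' y'] /=; nra.
Qed.

Lemma norm_mirror_gt zs s : zs != [::] -> {in zs, forall z, Rez z < 0} ->
  Rez s < 0 -> `|(prodX zs).[s]| < `|(prodX (mirror zs)).[s]|.
Proof.
move=> zs0 zsN s0; rewrite !horner_prodX big_map !normr_prod big_seq [ltRHS]big_seq.
apply: ltr_prod.
  by case: zs zs0 {zsN} => //= z zs _; rewrite inE eqxx.
move=> z /zsN {zsN zs0}; rewrite normr_ge0 /=.
rewrite -(ltr_pXn2r (n := 2)) ?nnegrE ?normr_ge0 // -!add_Re2_Im2 ltcR.
case: z s s0 => x y [x' y'] /=; nra.
Qed.

(** On the axis 1/(s + conj z) = -conj (1/(s - z)), so each difference is w + conj w with w = 1/(s -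
    z). *)
Lemma logderiv_mirror zs s : Rez s = 0 ->
  \sum_(z <- zs) (s - z)^-1 - \sum_(z <- mirror zs) (s - z)^-1 =
  real_complex R (2 * \sum_(z <- zs) Rez (s - z)^-1).
Proof.
move=> /conjc_axis s0; rewrite big_map -sumrB rmorphM rmorph_sum mulr_sumr /=.
apply: eq_bigr => z _; rewrite rmorph_nat -addcJ.
rewrite conjc_inv rmorphB /= s0; congr (_ + _); rewrite -invrN; congr (_^-1).
ring.
Qed.

Lemma sum_Re_inv_gt0 zs s : zs != [::] -> {in zs, forall z, Rez z < 0} ->
  Rez s = 0 -> 0 < \sum_(z <- zs) Rez (s - z)^-1.
Proof.
move=> zs0 zsN s0; rewrite big_seq.
have {1}<- : \sum_(z <- zs | z \in zs) (0 : R) = 0 by exact: big1.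
apply: ltr_sum.
  by case: zs zs0 {zsN} => //= z zs _; rewrite inE eqxx.
by move=> z /zsN zN; rewrite Re_inv_gt0 // ReD s0 add0r raddfN oppr_gt0.
Qed.

Lemma horner_axis_neq0 zs s : {in zs, forall z, Rez z < 0} ->
  Rez s = 0 -> (prodX zs).[s] != 0.
Proof.
move=> zsN s0; rewrite -rootE root_prod_XsubC; apply/negP => /zsN.
by rewrite s0 ltxx.
Qed.

Lemma norm_mirror_axis zs s : Rez s = 0 ->
  `|(prodX (mirror zs)).[s]| = `|(prodX zs).[s]|.
Proof.
by move=> s0; rewrite horner_mirror // normrM normrX normrN1 expr1n mul1r normcJ.
Qed.

(** The map v -> 1/(1 - v) sends the unit circle to the line Re = 1/2, because |1 - v|^2 = 2 (1 - Re
    v). *)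
Lemma Re_inv_1sub v : `|v| = 1 -> v != 1 -> Rez (1 - v)^-1 = 2^-1.
Proof.
move=> /(congr1 (fun x => x ^+ 2)); rewrite -add_Re2_Im2 expr1n.
case: v => x y; rewrite eq_complex /= => -[xy].
move=> v1; rewrite sub0r sqrrN.
have -> : (1 - x) ^+ 2 + y ^+ 2 = 2 * (1 - x).
  by rewrite -[y ^+ 2](addKr (x ^+ 2)) xy; ring.
rewrite invfM mulrCA divff ?mulr1 // subr_eq0 eq_sym.
apply: contraNneq v1 => x1; rewrite x1 in xy *.
move: xy; rewrite expr1n -[RHS]addr0 => /addrI/eqP.
by rewrite sqrf_eq0 => ->; rewrite eqxx.
Qed.

(** The last hypothesis says v <> 1, so the leading coefficient 1 - v of q does not vanish. *)
Lemma Re_quotient_le zs (B : {poly R[i]}) s0 : zs != [::] ->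
  {in zs, forall z, Rez z < 0} ->
  (size B <= size zs)%N -> B`_(size zs).-1 = 1 ->
  (forall s, Rez s = 0 -> 0 <= Rez (B.[s] / (prodX zs).[s])) ->
  Rez s0 = 0 -> (prodX zs).[s0] != (prodX (mirror zs)).[s0] ->
  Rez (B.[s0] / (prodX zs).[s0]) <= \sum_(z <- zs) Rez (s0 - z)^-1.
Proof.
move=> zs0 zsN sB B1 Bpos Re_s0 AA2.
set A := prodX zs in Bpos AA2 *; set A2 := prodX (mirror zs) in AA2 *.
set n := size zs in sB B1.
have n0 : (0 < n)%N by rewrite lt0n size_eq0.
have A0 s : Rez s = 0 -> A.[s] != 0 by exact: horner_axis_neq0.
have A20 s : Rez s = 0 -> A2.[s] != 0.
  by move=> sR; rewrite -normr_eq0 norm_mirror_axis // normr_eq0 A0.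
pose v := A.[s0] / A2.[s0].
have v1 : v != 1.
  rewrite -subr_eq0 -(mulIr_eq0 _ (mulIf (A20 _ Re_s0))) mulrBl mul1r.
  by rewrite divfK ?A20 // subr_eq0.
have nv : `|v| = 1.
  by rewrite normrM normfV norm_mirror_axis // divff // normr_eq0 A0.
have v10 : 1 - v != 0 by rewrite subr_eq0 eq_sym.
pose Q := A - v *: A2.
have sA : size A = n.+1 by exact: size_prodX.
have sA2 : size A2 = n.+1.
  by rewrite /A2 size_prodX size_map.
have mA : A \is monic by exact: monic_prod_XsubC.
have mA2 : A2 \is monic by exact: monic_prod_XsubC.
have Qn : Q`_n = 1 - v.
  rewrite coefB coefZ; move: (monicP mA) (monicP mA2).
  by rewrite /lead_coef sA sA2 => -> ->; rewrite mulr1.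
have sQ : size Q = n.+1.
  apply/eqP; rewrite eqn_leq; apply/andP; split; last first.
    rewrite ltnNge; apply/negP => /leq_sizeP/(_ n (leqnn _))/eqP.
    by rewrite Qn; apply/negP.
  rewrite (leq_trans (size_polyD _ _)) // geq_max sA leqnn size_polyN.
  by rewrite (leq_trans (size_scale_leq _ _)) ?sA2.
have [rs] := closed_field_poly_normal Q.
rewrite /lead_coef sQ Qn => eqQ.
have srs : size rs = n.
  by move: sQ; rewrite eqQ size_scale // size_prodX => -[].
have Qroot r : r \in rs -> A.[r] = v * A2.[r].
  move=> rrs; apply/eqP; rewrite -subr_eq0 -hornerZ -hornerN -hornerD -/Q eqQ.
  by rewrite hornerZ mulf_eq0 -[X in _ || X]rootE root_prod_XsubC rrs orbT.
have Re_rs r : r \in rs -> Rez r = 0.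
  move=> /Qroot/(congr1 Num.norm); rewrite normrM nv mul1r => eqA.
  case: (ltgtP (Rez r) 0) => // Rr.
    by have := norm_mirror_gt _ _ zs0 zsN Rr; rewrite -/A -/A2 eqA ltxx.
  by have := norm_mirror_lt _ _ zs0 zsN Rr; rewrite -/A -/A2 eqA ltxx.
pose D r := 2 * \sum_(z <- zs) Rez (r - z)^-1.
have D0 r : Rez r = 0 -> 0 < D r.
  by move=> r0; rewrite mulr_gt0 // sum_Re_inv_gt0.
(* At a root, v a~(r) can be replaced by a(r), which leaves a(r) times the difference of the
   logarithmic derivatives. *)
have Q' r : r \in rs -> Q^`().[r] = A.[r] * real_complex R (D r).
  move=> rrs; rewrite derivB derivZ hornerD hornerN hornerZ.
  have r0 := Re_rs _ rrs.
  rewrite !deriv_prodX -1?root_prod_XsubC ?rootE ?A0 ?A20 //.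
  by rewrite mulrA -Qroot // -mulrBr logderiv_mirror.
have urs : uniq rs.
  rewrite -separable_prod_XsubC unlock; apply: Pdiv.ClosedField.root_coprimep => r.
  rewrite root_prod_XsubC => rrs.
  have := Q' _ rrs; rewrite eqQ derivZ hornerZ => Q'r.
  apply: contraTneq isT => P'0; move: Q'r; rewrite P'0 mulr0 => /esym/eqP.
  rewrite mulf_eq0 (negPf (A0 _ _)) ?Re_rs //= => /eqP[] Dr.
  by have := D0 _ (Re_rs _ rrs); rewrite Dr ltxx.
(* [Q] is [1 - v] times the product over [rs], so its derivative at [r] is [1 - v] times the
   Lagrange factor there. *)
have lf r : r \in rs ->
    (lagrange_factor _ rs r).[r]^-1 =
    (1 - v) * (A.[r]^-1 * real_complex R (D r)^-1).
  move=> rrs; have := Q' _ rrs.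
  rewrite eqQ derivZ hornerZ deriv_prodX_root // => Er.
  have Dr : real_complex R (D r) != 0 by rewrite fmorph_eq0 gt_eqF ?D0 ?Re_rs.
  by rewrite fmorphV -invfM -Er invfM mulVKf.
have sum1 : (1 - v)^-1 =
    \sum_(r <- rs) real_complex R (D r)^-1 * (B.[r] / A.[r]).
  apply: (mulfI v10); rewrite divff // -[LHS]B1.
  rewrite {1}(lagrange_interpolation _ _ urs B) ?srs // coef_sum mulr_sumr.
  rewrite big_seq [RHS]big_seq; apply: eq_bigr => r rrs; rewrite coefZ.
  have -> : (lagrange_factor _ rs r)`_n.-1 = 1.
    have /monicP := monic_lagrange_factor _ rs r.
    by rewrite /lead_coef size_lagrange_factor ?srs.
  by rewrite lf //; ring.
have {sum1} sum2 : 2^-1 = \sum_(r <- rs) (D r)^-1 * Rez (B.[r] / A.[r]).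
  rewrite -(Re_inv_1sub v) // sum1 Re_sum.
  by apply: eq_bigr => r _; rewrite Re_realM.
have s0rs : s0 \in rs.
  rewrite -root_prod_XsubC -(rootZ _ _ v10) -eqQ rootE !hornerE.
  by rewrite divfK ?A20 // subrr.
(* Only the term at [s0] is kept; multiplying by [D s0] then gives [D s0] / 2, the claimed sum. *)
have : (D s0)^-1 * Rez (B.[s0] / A.[s0]) <= 2^-1.
  rewrite sum2 (bigD1_seq s0) //= lerDl big_seq_cond.
  rewrite sumr_ge0 // => r /andP[rrs _].
  by rewrite mulr_ge0 ?Bpos ?invr_ge0 ?ltW ?D0 ?Re_rs.
by rewrite mulrC ler_pdivrMr ?D0 // mulrA mulVf ?mul1r // pnatr_eq0.
Qed.

End HermiteBiehler.

(** * From values on the axis to bounds on coefficients *)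

Section Boundedness.
Variable R : realType.
Implicit Types (zs : seq R[i]) (B : {poly R[i]}).

Local Notation Rez z := (complex.Re z) (only parsing).

(** Of [m + size E] distinct points on the axis, fewer than [size E] are roots of [E]. *)
Lemma axis_nonroots (E : {poly R[i]}) (m : nat) : E != 0 ->
  exists pts : seq R[i], [/\ uniq pts, (m <= size pts)%N &
    {in pts, forall s, Rez s = 0 /\ ~~ root E s}].
Proof.
move=> E0; pose l := [seq (0 +i* k%:R)%C | k <- iota 0 (m + size E)] : seq R[i].
have ul : uniq l.
  rewrite map_inj_uniq ?iota_uniq // => k k' [] /eqP.
  by rewrite eqr_nat => /eqP.
exists [seq s <- l | ~~ root E s]; split; first exact: filter_uniq.
  have := count_predC (root E) l; rewrite size_map size_iota => eqm.
  rewrite size_filter -(leq_add2r (size E)) -eqm addnC leq_add2l.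
  rewrite ltnW // -size_filter; apply: max_poly_roots => //.
    exact: filter_all.
  exact: filter_uniq.
by move=> s; rewrite mem_filter => /andP[rE /mapP[k _ sE]]; rewrite sE in rE *.
Qed.

(** The two root sets lie in opposite open half-planes. *)
Lemma coprime_mirror zs : {in zs, forall z, Rez z < 0} ->
  coprimep (prodX zs) (prodX (mirror R zs)).
Proof.
move=> zsN; apply: Pdiv.ClosedField.root_coprimep => z.
rewrite root_prod_XsubC => zzs; rewrite -rootE root_prod_XsubC.
apply/mapP => -[t /zsN + zt]; move: (zsN _ zzs); rewrite zt.
by case: t {zt} => x y /=; rewrite oppr_lt0 => x0 /(lt_trans x0); rewrite ltxx.
Qed.

(** The b^* of the overview: conjugating coefficients and substituting -s conjugates values where
    conj s = -s. *)
Definition conj_mirror B : {poly R[i]} :=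
  map_poly (conjc (R := R)) B \Po (- 'X).

Lemma size_conj_mirror B : size (conj_mirror B) = size B.
Proof. by rewrite size_comp_poly2 ?size_map_poly // size_polyN size_polyX. Qed.

Lemma horner_conj_mirror B s : Rez s = 0 ->
  (conj_mirror B).[s] = conjc B.[s].
Proof.
move=> s0; rewrite horner_comp !hornerE -(conjc_axis _ _ s0).
exact: horner_map.
Qed.

(* Equals 2 (-1)^n Re (B conj A) on the imaginary axis, A = prodX zs. *)
Definition axis_form zs B : {poly R[i]} :=
  B * prodX (mirror R zs) + (-1) ^+ size zs *: (conj_mirror B * prodX zs).

Lemma size_axis_form zs B : (size B <= size zs)%N ->
  (size (axis_form zs B) <= size zs + size zs)%N.
Proof.
move=> sB; rewrite (leq_trans (size_polyD _ _)) // geq_max; apply/andP; split.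
  rewrite (leq_trans (size_polyMleq _ _)) // size_prodX size_map addnS /=.
  by rewrite leq_add2r.
rewrite (leq_trans (size_scale_leq _ _)) // (leq_trans (size_polyMleq _ _)) //.
by rewrite size_prodX addnS /= leq_add2r size_conj_mirror.
Qed.

Lemma norm_axis_form zs B s : {in zs, forall z, Rez z < 0} -> Rez s = 0 ->
  `|(axis_form zs B).[s]| = 2 * `|(prodX zs).[s]| ^+ 2 *
    `|real_complex R (Rez (B.[s] / (prodX zs).[s]))|.
Proof.
move=> zsN s0; have A0 := horner_axis_neq0 _ _ _ zsN s0.
rewrite hornerD hornerZ !hornerM horner_mirror // horner_conj_mirror //.
set A := (prodX zs).[s] in A0 *; set b := B.[s].
have -> : b * ((-1) ^+ size zs * conjc A) +
    (-1) ^+ size zs * (conjc b * A) =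
    (-1) ^+ size zs * (`|A| ^+ 2 * (b / A + conjc (b / A))).
  have cA0 : conjc A != 0 by rewrite conjc_eq0.
  by rewrite sqr_normc rmorphM fmorphV /=; field; rewrite A0 cA0.
rewrite normrM normrX normrN1 expr1n mul1r addcJ !normrM normr_id.
by rewrite normr_nat; ring.
Qed.

(** Modulo [prodX zs] the second summand of the form vanishes and [V] inverts the mirror product;
    [B] is its own remainder by its size. *)
Lemma axis_form_bezout zs (U V B : {poly R[i]}) : (size B <= size zs)%N ->
  U * prodX zs + V * prodX (mirror R zs) = 1 ->
  B = (axis_form zs B * V) %% prodX zs.
Proof.
move=> sB UV; rewrite (_ : axis_form zs B * V =
  B + ((-1) ^+ size zs *: conj_mirror B * V - B * U) * prodX zs).
  by rewrite modpD modp_mull addr0 modp_small // size_prodX ltnS.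
have {2}-> : B = B * U * prodX zs + B * V * prodX (mirror R zs).
  by rewrite -!mulrA -mulrDr UV mulr1.
rewrite /axis_form -!mul_polyC; ring.
Qed.

Lemma coef_bounded zs : zs != [::] -> {in zs, forall z, Rez z < 0} ->
  exists c : nat -> R[i], forall B,
    (size B <= size zs)%N -> B`_(size zs).-1 = 1 ->
    (forall s, Rez s = 0 -> 0 <= Rez (B.[s] / (prodX zs).[s])) ->
    forall i, `|B`_i| <= c i.
Proof.
move=> zs0 zsN; set A := prodX zs; set A2 := prodX (mirror R zs).
have cop : coprimep A A2 := coprime_mirror _ zsN.
have /Bezout_eq1_coprimepP[[U V] /= UV] := cop.
(* A polynomial coprime to itself is constant, but [A] has positive degree. *)
have A1 : A - A2 != 0.
  rewrite subr_eq0; apply: contraTneq cop => <-.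
  by rewrite coprimepp size_prodX eqSS size_eq0.
(* The form has size at most 2n, so 2n nodes determine it; they avoid the points excluded in
   [Re_quotient_le]. *)
have [pts [upts mpts ptsP]] := axis_nonroots _ (size zs + size zs) A1.
pose lf := lagrange_factor _ pts.
(* Triangle inequality for the interpolated form, multiplied by [V] and reduced modulo [A], with
   each nodal value replaced by its bound. *)
exists (fun i => \sum_(r <- pts)
  2 * `|A.[r]| ^+ 2 * real_complex R (\sum_(z <- zs) Rez (r - z)^-1) *
  `|(lf r).[r]^-1 * ((lf r * V) %% A)`_i|) => B sB B1 Bpos i.
have sN := leq_trans (size_axis_form _ _ sB) mpts.
rewrite {1}(axis_form_bezout _ _ _ _ sB UV).
rewrite (lagrange_interpolation _ _ upts _ sN) -/lf mulr_suml.
rewrite (big_morph _ (modpD A) (mod0p A)) coef_sum.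
apply: (le_trans (ler_norm_sum _ _ _)).
rewrite big_seq [leRHS]big_seq; apply: ler_sum => r rpts.
have [r0 rA] := ptsP _ rpts.
rewrite -scalerAl modpZl coefZ -[in leLHS]mulrA normrM ler_wpM2r //.
rewrite norm_axis_form // -/A ler_wpM2l ?mulr_ge0 ?exprn_ge0 //.
rewrite ger0_norm ?ler0c ?Bpos // lecR Re_quotient_le //.
by move: rA; rewrite rootE !hornerE subr_eq0.
Qed.

End Boundedness.

(** * Coordinates versus coefficients of monic numerators *)

Section MonicNumerators.
Variables (R : realType) (n : nat).
Implicit Types x y : 'rV[R]_n.-1.

Lemma monic_num_rev x : monic_num x =
  'X^(n.-1) + \sum_(i < n.-1) x 0 (rev_ord i) *: 'X^i.
Proof.
rewrite /monic_num; congr (_ + _); rewrite (reindex_inj rev_ord_inj) /=.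
by apply: eq_bigr => i _; rewrite subnSK // subKn // ltnW.
Qed.

Lemma size_monic_num x : size (monic_num x) = n.-1.+1.
Proof.
rewrite monic_num_rev size_polyDl size_polyXn // ltnS.
rewrite (leq_trans (size_sum _ _ _)) //; apply/bigmax_leqP => i _.
by rewrite (leq_trans (size_scale_leq _ _)) // size_polyXn.
Qed.

Lemma coef_monic_num_top x : (monic_num x)`_n.-1 = 1.
Proof.
rewrite monic_num_rev coefD coefXn eqxx coef_sum big1 ?addr0 // => i _.
by rewrite coefZ coefXn gtn_eqF ?mulr0.
Qed.

Lemma coef_monic_num x (i : 'I_n.-1) : (monic_num x)`_i = x 0 (rev_ord i).
Proof.
rewrite monic_num_rev coefD coefXn ltn_eqF // add0r coef_sum.
rewrite (bigD1 i) //= coefZ coefXn eqxx mulr1 big1 ?addr0 // => j ji.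
by rewrite coefZ coefXn eq_sym (negPf (ji : val j != val i)) mulr0.
Qed.

Lemma monic_num_surj (p : {poly R}) : (size p <= n.-1.+1)%N ->
  p`_n.-1 = 1 -> exists x, monic_num x = p.
Proof.
move=> sp p1; exists (\row_(i < n.-1) p`_(rev_ord i)).
apply/polyP => k; case: (ltngtP k n.-1) => kn.
- by rewrite (coef_monic_num _ (Ordinal kn)) mxE rev_ordK.
- by rewrite !nth_default // ?size_monic_num // (leq_trans sp).
- by rewrite kn coef_monic_num_top p1.
Qed.

(** The weights sum to 1, so the leading coefficient stays 1. *)
Lemma monic_num_conv (k : R) x y :
  monic_num (k *: x + (1 - k) *: y) =
  k *: monic_num x + (1 - k) *: monic_num y.
Proof.
apply/polyP => i; rewrite [RHS]coefD !coefZ; case: (ltngtP i n.-1) => kn.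
- by rewrite !(coef_monic_num _ (Ordinal kn)) !mxE.
- by rewrite !nth_default ?size_monic_num // !mulr0 addr0.
- by rewrite kn !coef_monic_num_top; ring.
Qed.

End MonicNumerators.

(** * Factoring the denominator, linearity in the numerator, and the theorem *)

Section Hurwitz.
Variable R : realType.

Local Notation Rez z := (complex.Re z) (only parsing).

Lemma hurwitz_roots (n : nat) (a : {poly R}) :
  a \is monic -> hurwitz_polys n a ->
  exists zs : seq R[i], [/\ map_poly (real_complex R) a = prodX zs,
    size zs = n & {in zs, forall z, Rez z < 0}].
Proof.
move=> am [sa aN].
have [zs] := closed_field_poly_normal (map_poly (real_complex R) a).
rewrite lead_coef_map (monicP am) rmorph1 scale1r => eqa.
exists zs; split=> //.
  by apply/eqP; rewrite -eqSS -(size_prodX _ zs) -eqa size_map_poly sa.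
by move=> z zzs; apply: aN; rewrite eqa root_prod_XsubC.
Qed.

Lemma ratfun_evalD (b c a : {poly R}) s :
  ratfun_eval (b + c) a s = ratfun_eval b a s + ratfun_eval c a s.
Proof. by rewrite /ratfun_eval rmorphD hornerD mulrDl. Qed.

Lemma ratfun_evalZ k (b a : {poly R}) s :
  ratfun_eval (k *: b) a s = real_complex R k * ratfun_eval b a s.
Proof. by rewrite /ratfun_eval map_polyZ hornerZ mulrA. Qed.

End Hurwitz.

Theorem theorem2 (R : realType) (n : nat) (n_ge1 : (1 <= n)%N)
    (a : {poly R}) (a_monic : a \is monic)
    (a_hurwitz : hurwitz_polys n a) :
  [/\ OmegaW1 n a !=set0,
      bounded_set (OmegaW1 n a) &
      convex_set (OmegaW1 n a)].
Proof.
have [zs [aE szs zsN]] := hurwitz_roots _ _ _ a_monic a_hurwitz.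
have zs0 : zs != [::] by rewrite -size_eq0 szs -lt0n.
have n1 : n.-1.+1 = n by rewrite prednK.
have [sa aN] := a_hurwitz.
split.
(* The witness is a'/n: a' has leading coefficient n, and Re (a'/a) is a sum of positive terms Re
   (1/(s - z)). *)
- have n0 : n%:R != 0 :> R by rewrite pnatr_eq0 -lt0n.
  have sda : (size (n%:R^-1 *: a^`()) <= n.-1.+1)%N.
    rewrite (leq_trans (size_scale_leq _ _)) // n1.
    by have := lt_size_deriv (monic_neq0 a_monic); rewrite sa ltnS.
  have [|x xE] := monic_num_surj _ _ _ sda.
    rewrite coefZ coef_deriv n1; have := monicP a_monic.
    by rewrite /lead_coef sa /= => ->; rewrite mulVf.
  exists x; split => // [|w]; first by rewrite /order_polys /= size_monic_num.
  set s := (0 +i* w)%C; have s0 : complex.Re s = 0 by [].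
  rewrite xE ratfun_evalZ Re_realM mulr_gt0 ?invr_gt0 ?ltr0n //.
  have As := horner_axis_neq0 _ _ _ zsN s0.
  rewrite /ratfun_eval -deriv_map aE deriv_prodX; last first.
    by rewrite -root_prod_XsubC rootE.
  by rewrite mulrAC divff // mul1r Re_sum sum_Re_inv_gt0.
- have [c cP] := coef_bounded _ _ zs0 zsN.
  (* The norm is the largest absolute entry, so the sum of all coefficient bounds dominates it. *)
  pose M := \sum_(i < n.-1) `|complex.Re (c i)|.
  exists M; split; first exact: num_real.
  move=> K MK x [_ _ xpos] /=; apply: le_trans (ltW MK).
  rewrite /Num.norm /= mx_normrE.
  apply: bigmax_le => [|[i j] _ /=]; first exact: sumr_ge0.
  rewrite ord1 -[j]rev_ordK -coef_monic_num.
  have sB : (size (map_poly (real_complex R) (monic_num x)) <= size zs)%N.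
    by rewrite size_map_poly size_monic_num n1 szs.
  have B1 : (map_poly (real_complex R) (monic_num x))`_(size zs).-1 = 1.
    by rewrite coef_map szs coef_monic_num_top.
  have := cP _ sB B1; rewrite -aE => /(_ _ (rev_ord j)) le_c.
  have {le_c} : `|(map_poly (real_complex R) (monic_num x))`_(rev_ord j)| <=
      c (rev_ord j).
    by apply: le_c => -[s1 s2] /= ->; apply/ltW/xpos.
  (* The order on [R[i]] compares real parts, which turns the complex bound into a real one. *)
  rewrite coef_map normc_def lecE /= => /andP[_].
  rewrite expr0n addr0 sqrtr_sqr => le_c.
  apply: (le_trans le_c); apply: (le_trans (ler_norm _)).
  by rewrite /M (bigD1 (rev_ord j)) //= lerDl sumr_ge0.
(* For weights strictly between 0 and 1, Re (b/a) of the combination is a positive combination of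
   positive values. *)
- apply/convex_setW => x y /set_mem[_ _ xpos] /set_mem[_ _ ypos] k k0 k1.
  apply/mem_set; split=> //; first by rewrite /order_polys /= size_monic_num.
  move=> w.
  rewrite [X in monic_num X](_ : _ = k%:num *: x + (1 - k%:num) *: y) //.
  rewrite monic_num_conv ratfun_evalD !ratfun_evalZ ReD !Re_realM.
  by rewrite addr_gt0 // mulr_gt0 // subr_gt0.
Qed.
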